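(* $\mathrm{PAR}\notin\mathrm{IS}^0{:}B(2n+3)$; that is, there is no $h:\mathbb{N}\to\mathbb{N}$ with $h(n)\le 2n+3$ for all sufficiently large $n$ such that for every $n\in\mathbb{N}$ some instruction sequence using no auxiliary registers computes $\mathrm{PAR}_n$ with length at most $h(n)$.
   Context: Booleans are $\mathrm{F}$ and $\mathrm{T}$. An instruction sequence is a finite sequence $u_1;u_2;\dots;u_k$ of primitive instructions; its length is $k$. Basic instructions are: $\mathrm{in}{:}i.\mathrm{get}$ ($i\ge1$), $\mathrm{out}.\mathrm{set}{:}b$ ($b\in\{\mathrm{F},\mathrm{T}\}$), $\mathrm{aux}{:}i.\mathrm{get}$, $\mathrm{aux}{:}i.\mathrm{set}{:}b$, $\mathrm{aux}{:}i.\mathrm{com}$ ($i\ge1$). Each names a Boolean register ($\mathrm{in}{:}i$ input, $\mathrm{out}$ output, $\mathrm{aux}{:}i$ auxiliary) and a command: $\mathrm{get}$ leaves the register unchanged and replies its content; $\mathrm{set}{:}b$ sets the content to $b$ and replies $b$; $\mathrm{com}$ complements the content and replies the new content. Primitive instructions: for each basic instruction $a$, plain $a$, positive test ${+}a$, negative test ${-}a$; forward jumps $\#l$ ($l\in\mathbb{N}$); termination $!$. Execution starts at $u_1$. ${+}a$ executes $a$ and proceeds with the next instruction if the reply is $\mathrm{T}$, otherwise skips the next instruction and proceeds with the one after; ${-}a$ likewise with replies reversed; plain $a$ executes $a$ and proceeds with the next instruction; $\#l$ proceeds with the $l$th next instruction; $!$ terminates. If $l=0$ or there is no instruction to proceed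 with, inaction occurs (no termination). $X$ computes $f:\{\mathrm{F},\mathrm{T}\}^n\to\{\mathrm{F},\mathrm{T}\}$ if there is $k\in\mathbb{N}$ (at least every auxiliary index used in $X$) such that for all $b_1,\dots,b_n$: starting with $\mathrm{in}{:}i$ containing $b_i$, $\mathrm{out}$ containing $\mathrm{F}$, and $\mathrm{aux}{:}1,\dots,\mathrm{aux}{:}k$ containing $\mathrm{F}$, execution terminates with $\mathrm{out}$ containing $f(b_1,\dots,b_n)$. $\mathrm{IS}^0$ is the set of instruction sequences in which no instruction involving any register $\mathrm{aux}{:}i$ occurs. For a set $\mathcal{I}$ of instruction sequences and $f:\mathbb{N}\to\mathbb{N}$, $\mathcal{I}{:}B(f(n))$ is the class of Boolean function families $(f_n)_{n\in\mathbb{N}}$ ($f_n$ $n$-ary) for which there exists $h:\mathbb{N}\to\mathbb{N}$ with $h(n)\le f(n)$ for all sufficiently large $n$ such that for all $n$ there is $X\in\mathcal{I}$ computing $f_n$ with length at most $h(n)$. $\mathrm{PAR}=(\mathrm{PAR}_n)_{n\in\mathbb{N}}$, where $\mathrm{PAR}_n(b_1,\dots,b_n)=\mathrm{T}$ iff the number of $\mathrm{T}$'s among $b_1,\dots,b_n$ is odd. *)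

(* Defs.v *)
From HB Require Import structures.
From mathcomp Require Import all_boot.

Set Implicit Arguments.
Unset Strict Implicit.
Unset Printing Implicit Defensive.

Definition reg_index := {i : nat | 0 < i}.

Inductive register := In of reg_index | Out | Aux of reg_index.

Definition register_eqb (r1 r2 : register) : bool :=
  match r1, r2 with
  | In i, In j => i == j
  | Out, Out => true
  | Aux i, Aux j => i == j
  | _, _ => false
  end.

Lemma register_eqP : Equality.axiom register_eqb.
Proof.
case=> [i||i] [j||j] /=; try by constructor.
- by apply: (iffP eqP) => [->|[]].
- by apply: (iffP eqP) => [->|[]].
Qed.

HB.instance Definition _ := hasDecEq.Build register register_eqP.

Inductive command := Get | SetTo of bool | Com.

(* Both the new content of the register and the reply: every command replies
   the content that it leaves in the register. *)
Definition command_effect (c : command) (content : bool) : bool :=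
  match c with
  | Get => content
  | SetTo b => b
  | Com => ~~ content
  end.

Inductive basic_instr :=
  | InGet of reg_index
  | OutSet of bool
  | AuxGet of reg_index
  | AuxSet of reg_index & bool
  | AuxCom of reg_index.

Definition basic_register (a : basic_instr) : register :=
  match a with
  | InGet i => In i
  | OutSet _ => Out
  | AuxGet i | AuxSet i _ | AuxCom i => Aux i
  end.

Definition basic_command (a : basic_instr) : command :=
  match a with
  | InGet _ | AuxGet _ => Get
  | OutSet b | AuxSet _ b => SetTo b
  | AuxCom _ => Com
  end.

Inductive prim_instr :=
  | Plain of basic_instr
  | PosTest of basic_instr
  | NegTest of basic_instr
  | Jump of nat
  | Halt.

Definition instr_seq := seq prim_instr.

(* [None] marks a register that is not available. *)
Definition state := register -> option bool.

Definition update (s : state) (r : register) (b : bool) : state :=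
  fun r' => if r' == r then Some b else s r'.

(* The reply and the new state; [None] if the register is not available. *)
Definition perform (a : basic_instr) (s : state) : option (bool * state) :=
  if s (basic_register a) is Some content then
    let b := command_effect (basic_command a) content in
    Some (b, update s (basic_register a) b)
  else None.

(* [Some (l, s')]: proceed with the [l]th next instruction in state [s'];
   [None]: termination (for [Halt]) or inaction. *)
Definition step (u : prim_instr) (s : state) : option (nat * state) :=
  match u with
  | Plain a => if perform a s is Some (_, s') then Some (1, s') else None
  | PosTest a =>
      if perform a s is Some (r, s') then Some (if r then 1 else 2, s')
      else None
  | NegTest a =>
      if perform a s is Some (r, s') then Some (if r then 2 else 1, s')
      else None
  | Jump l => if l == 0 then None else Some (l, s)
  | Halt => None
  end.

(* [run X p s s']: execution of [X] from position [p] (counted from 0) in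
   state [s] terminates in state [s'].  Inaction yields no derivation; in
   particular [onth X p = None] when [p] is past the end of [X]. *)
Inductive run (X : instr_seq) : nat -> state -> state -> Prop :=
  | RunHalt p s : onth X p = Some Halt -> run X p s s
  | RunStep p s u l s1 s' :
      onth X p = Some u -> step u s = Some (l, s1) ->
      run X (p + l) s1 s' -> run X p s s'.

Definition instr_basic (u : prim_instr) : option basic_instr :=
  match u with
  | Plain a | PosTest a | NegTest a => Some a
  | Jump _ | Halt => None
  end.

Definition instr_aux (u : prim_instr) : option reg_index :=
  if instr_basic u is Some a then
    if basic_register a is Aux i then Some i else None
  else None.

(* Exactly the registers in:1, ..., in:n, out, aux:1, ..., aux:k are available;
   the tuple [b] is indexed from 0, so in:i contains its component [i.-1]. *)
Definition init_state (n k : nat) (b : n.-tuple bool) : state :=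
  fun r => match r with
  | In i => onth b (val i).-1
  | Out => Some false
  | Aux i => if val i <= k then Some false else None
  end.

Definition computes (X : instr_seq) (n : nat) (f : n.-tuple bool -> bool) :
    Prop :=
  exists k : nat,
    all (fun u => if instr_aux u is Some i then val i <= k else true) X /\
    forall b : n.-tuple bool, exists s' : state,
      run X 0 (init_state k b) s' /\ s' Out = Some (f b).

Definition IS0 (X : instr_seq) : Prop :=
  all (fun u => instr_aux u == None) X.

Definition bool_fun_family := forall n : nat, n.-tuple bool -> bool.

Definition complexity_class (I : instr_seq -> Prop) (f : nat -> nat)
    (F : bool_fun_family) : Prop :=
  exists h : nat -> nat,
    (exists N : nat, forall n : nat, N <= n -> h n <= f n) /\
    (forall n : nat, exists X : instr_seq,
       [/\ I X, computes X (@F n) & size X <= h n]).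

Definition PAR : bool_fun_family := fun n b => odd (count_mem true b).

(* Main.v *)
(* Without auxiliary registers the control flow depends on the inputs only, and
   at most one input can be tested just once.  So 2n-2 of the at most 2n+3
   instructions are tests that give every other input two tests, and for large
   n some input j is such that each of its at most two tests is followed by
   two tests of inputs that are themselves tested at most twice.  A test of j
   splits the execution into two branches at adjacent positions, and these stay
   adjacent, until they meet at the first test that proceeds with the next
   instruction.  The other inputs can be chosen such that this happens after
   each test of j; then the result does not depend on j. *)

Require Import Defs.
From mathcomp Require Import all_boot zify.

Set Implicit Arguments.
Unset Strict Implicit.
Unset Printing Implicit Defensive.

(** * Execution and the input registers *)

Definition input (s : state) (k : nat) : option bool :=
  s (In (exist _ k.+1 (ltn0Sn k))).

Lemma inputE s i : s (In i) = input s (val i).-1.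
Proof.
by rewrite /input; congr (s (In _)); apply: val_inj; case: i => -[].
Qed.

(* The input register in:i has index [i.-1], its index in the input tuple. *)
Definition test_var (u : prim_instr) : option nat :=
  match u with
  | PosTest (InGet i) | NegTest (InGet i) => Some (val i).-1
  | _ => None
  end.

(** The reply after which a test proceeds with the next instruction instead of skipping it. *)
Definition step_reply (u : prim_instr) : bool :=
  if u is PosTest _ then true else false.

Lemma step_input u s l s1 :
  step u s = Some (l, s1) -> input s1 =1 input s.
Proof.
have perform_input a b s2 : perform a s = Some (b, s2) -> input s2 =1 input s.
  rewrite /perform /input; case Ea: (s (basic_register a)) => [c|//] [_ <-] k.
  rewrite /update; case: eqP => // Ek.
  by rewrite Ek Ea; case: a Ea Ek.
case: u => [a|a|a|l'|] //=.
- by case Ea: (perform a s) => [[b s2]|//] [_ <-]; apply: perform_input Ea.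
- by case Ea: (perform a s) => [[b s2]|//] [_ <-]; apply: perform_input Ea.
- by case Ea: (perform a s) => [[b s2]|//] [_ <-]; apply: perform_input Ea.
- by case: eqP => // _ [_ <-].
Qed.

Lemma step_test u s l s1 i :
  step u s = Some (l, s1) -> test_var u = Some i ->
  s1 Out = s Out /\
  exists2 b, input s i = Some b & l = if b == step_reply u then 1 else 2.
Proof.
case: u => [//|a|a|//|//] /=; case: a => //= r; rewrite /perform /= inputE;
  case E: (input s _) => [b|//] [<- <-] [Ei]; subst i; split=> //;
  by exists b => //; case: b {E}.
Qed.

Lemma step_gt0 u s l s1 : step u s = Some (l, s1) -> 0 < l.
Proof.
case: u => [a|a|a|l'|] //=.
- by case: perform => [[b s2]|//] [<-].
- by case: perform => [[[] s2]|//] [<-].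
- by case: perform => [[[] s2]|//] [<-].
- by case: l' => //= l' [<-].
Qed.

(** Without auxiliary registers a reply is an input or the constant just written to out, so
    agreement on the tested input fixes the path. Out is either left alone in both states or
    overwritten by the same constant. *)
Lemma step_indep u s s' l l' s1 s1' :
  instr_aux u = None ->
  step u s = Some (l, s1) -> step u s' = Some (l', s1') ->
  (forall i, test_var u = Some i -> input s i = input s' i) ->
  l = l' /\
  (s1 Out = s Out /\ s1' Out = s' Out \/ s1 Out = s1' Out).
Proof.
move=> aux; case Et: (test_var u) => [i|].
  move=> /step_test/(_ Et)[-> [b Eb ->]] /step_test/(_ Et)[-> [b' Eb' ->]].
  move=> /(_ i erefl); rewrite Eb Eb' => -[->]; by split; [|left].
case: u aux Et => [a|a|a|k|] //=.
- case: a => //= [r|b] _ _; rewrite /perform /=.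
  + case: (s _) => [c|//] [<- <-]; case: (s' _) => [c'|//] [<- <-] _.
    by split; [|left].
  + case: (s _) => [c|//] [<- <-]; case: (s' _) => [c'|//] [<- <-] _.
    by split; [|right].
- case: a => //= b _ _; rewrite /perform /=.
  case: (s _) => [c|//] [<- <-]; case: (s' _) => [c'|//] [<- <-] _.
  by split; [|right].
- case: a => //= b _ _; rewrite /perform /=.
  case: (s _) => [c|//] [<- <-]; case: (s' _) => [c'|//] [<- <-] _.
  by split; [|right].
- by case: eqP => // _ _ _ [<- <-] [<- <-] _; split; [|left].
Qed.

Lemma IS0_onth X p u : IS0 X -> onth X p = Some u -> instr_aux u = None.
Proof.
by elim: X p => [|v X IH] [|p] //= /andP[/eqP v0 /IH X0]; [case=> <-|apply: X0].
Qed.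

(** * Two inputs tested at most once each *)

Lemma run_until_test X j q p s t :
  IS0 X ->
  (forall p' u, onth X p' = Some u -> test_var u = Some j -> p' = q) ->
  run X p s t -> forall s' t', run X p s' t' -> s Out = s' Out ->
  (forall k, k != j -> input s k = input s' k) ->
  t Out = t' Out \/
  exists r r', [/\ run X q r t, run X q r' t', r Out = r' Out,
    input r =1 input s & input r' =1 input s'].
Proof.
move=> X0 jq; elim=> {p s t} [p s Ep|p s u l s1 t Ep Eu run1 IH] s' t' run' out io.
  inversion run' as [? ? H|? ? ? ? ? ? H Eu]; subst; first by left.
  by rewrite Ep in H; case: H Eu => <-.
inversion run' as [? ? H|? ? u' l' s1' ? H H0 H1]; subst.
  by rewrite Ep in H; case: H Eu => ->.
rewrite Ep in H; case: H => ?; subst u'.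
case: (test_var u =P Some j) => [Ej|NEj].
  have ?: p = q by apply: jq Ep Ej.
  subst q; right; exists s, s'; split=> //.
  by apply: RunStep Ep Eu run1.
have [ll oo]: l = l' /\ (s1 Out = s Out /\ s1' Out = s' Out \/ s1 Out = s1' Out).
  apply: step_indep (IS0_onth X0 Ep) Eu H0 _ => i Ei; apply: io.
  by apply/eqP => ij; apply: NEj; rewrite Ei ij.
subst l'; case: (IH s1' t') => //.
- by case: oo => [[-> ->]|].
- by move=> k kj; rewrite (step_input Eu) (step_input H0) io.
- by left.
- case=> r [r' [r1 r2 r3 r4 r5]]; right; exists r, r'; split=> //.
    by move=> k; rewrite r4 (step_input Eu).
  by move=> k; rewrite r5 (step_input H0).
Qed.

(** Both executions follow one path: either an instruction on it sets out, which makes the final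
    contents equal, or out keeps its content in both. *)
Lemma run_untested X i p s t :
  IS0 X -> run X p s t ->
  (forall p' u, p <= p' -> onth X p' = Some u -> test_var u != Some i) ->
  forall s' t', run X p s' t' ->
  (forall k, k != i -> input s k = input s' k) ->
  t Out = t' Out \/ t Out = s Out /\ t' Out = s' Out.
Proof.
move=> X0; elim=> {p s t} [p s Ep|p s u l s1 t Ep Eu run1 IH] ni s' t' run' io.
  inversion run' as [? ? H|? ? ? ? ? ? H Eu]; subst; first by right.
  by rewrite Ep in H; case: H Eu => <-.
inversion run' as [? ? H|? ? u' l' s1' ? H H0 H1]; subst.
  by rewrite Ep in H; case: H Eu => ->.
rewrite Ep in H; case: H => ?; subst u'.
have [ll oo]: l = l' /\ (s1 Out = s Out /\ s1' Out = s' Out \/ s1 Out = s1' Out).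
  apply: step_indep (IS0_onth X0 Ep) Eu H0 _ => k Ek; apply: io.
  by apply/eqP => ki; move: (ni _ _ (leqnn p) Ep); rewrite Ek ki eqxx.
subst l'; case: (IH _ s1' t') => //.
- by move=> p' v pp'; apply: ni; apply: leq_trans (leq_addr _ _) pp'.
- by move=> k ki; rewrite (step_input Eu) (step_input H0) io.
- by left.
- by case=> -> ->; case: oo => [[-> ->]|->]; [right|left].
Qed.

Definition flip (f : nat -> bool) (j k : nat) : bool := f k (+) (k == j).

Definition parity (n : nat) (f : nat -> bool) : bool := odd (count f (iota 0 n)).

Lemma parity_flip n f j : j < n -> parity n (flip f j) = ~~ parity n f.
Proof.
move=> jn; rewrite /parity.
have ->: odd (count (flip f j) (iota 0 n)) =
         odd (count f (iota 0 n)) (+) odd (count_mem j (iota 0 n)).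
  elim: (iota 0 n) => //= k s IH.
  by rewrite !oddD IH !oddb /flip addbACA.
by rewrite count_uniq_mem ?iota_uniq // mem_iota jn addbT.
Qed.

(** Assignments are functions on all of [nat], which makes flipping one input easy; [init] hides the
    tuples and the number of auxiliary registers. *)
Definition computes_parity (X : instr_seq) (n : nat) (init : (nat -> bool) -> state) :=
  forall f, [/\ forall k, input (init f) k = if k < n then Some (f k) else None,
    init f Out = Some false &
    exists2 t, run X 0 (init f) t & t Out = Some (parity n f)].

Lemma computes_PAR X n : computes X (@PAR n) ->
  exists init, computes_parity X n init.
Proof.
case=> k [_ Hrun]; exists (fun f => init_state k [tuple f i | i < n]) => f.
have Ef: [tuple f i | i < n] = mkseq f n :> seq bool.
  by rewrite /mkseq -val_enum_ord -map_comp.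
split=> //.
- move=> i; rewrite /input [init_state _ _ _]/= Ef.
  case: ltnP => iN; last by apply: onth_default; rewrite size_mkseq.
  by rewrite onthE (nth_map false) ?size_mkseq // nth_mkseq.
- have [t [rt ot]] := Hrun [tuple f i | i < n]; exists t => //; rewrite ot /PAR.
  rewrite Ef count_map; congr (Some (odd _)); apply: eq_count => i /=.
  by rewrite eqb_id.
Qed.

(* All four assignments to i and j reach [q], and the value of out there does
   not depend on j. After [q], i only matters through that value, so the value
   must survive to the end, and then j does not matter. *)
Lemma single_tests X n init i j q :
  IS0 X -> computes_parity X n init -> i < n -> j < n -> i != j ->
  (forall p u, onth X p = Some u -> test_var u = Some j -> p = q) ->
  (forall p u, q <= p -> onth X p = Some u -> test_var u != Some i) -> False.
Proof.
move=> X0 Xn iN jN ij jq ni.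
have split_at f : exists r r' t t',
  [/\ run X q r t, run X q r' t', r Out = r' Out,
   input r =1 input (init f) & input r' =1 input (init (flip f j))] /\
   t Out = Some (parity n f) /\ t' Out = Some (~~ parity n f).
  have [in1 o1 [t rt ot]] := Xn f; have [in2 o2 [t' rt' ot']] := Xn (flip f j).
  rewrite parity_flip // in ot'.
  have := run_until_test X0 jq rt rt'; rewrite o1 o2 => /(_ erefl).
  case=> [k kj||].
  - by rewrite in1 in2 /flip (negbTE kj) addbF.
  - by rewrite ot ot' => -[]; case: parity.
  - by move=> [r [r' H]]; exists r, r', t, t'.
have [r [r' [t [t' [[run1 run2 or ir ir'] [ot ot']]]]]] := split_at (fun=> false).
have [v [v' [w [w' [[run3 run4 ov iv iv'] [ow ow']]]]]] := split_at (flip (fun=> false) i).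
rewrite parity_flip // in ow ow'.
have := run_untested X0 run1 ni run3; case.
- move=> k ki; rewrite ir iv.
  have [-> _ _] := Xn (fun=> false); have [-> _ _] := Xn (flip (fun=> false) i).
  by rewrite /flip (negbTE ki).
- by rewrite ot ow => -[]; case: parity.
move=> [ro _]; have := run_untested X0 run2 ni run4; case.
- move=> k ki; rewrite ir' iv'.
  have [-> _ _] := Xn (flip (fun=> false) j).
  have [-> _ _] := Xn (flip (flip (fun=> false) i) j).
  by rewrite /flip (negbTE ki).
- by rewrite ot' ow' => -[]; case: parity.
by move=> [ro' _]; move: ot'; rewrite ro' -or -ro ot => -[]; case: parity.
Qed.

(** * Branches that merge again *)

Definition var_at (X : instr_seq) (p : nat) : option nat :=
  obind test_var (onth X p).

Definition reply_at (X : instr_seq) (p : nat) : bool :=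
  oapp step_reply false (onth X p).

(* Two executions that are at [p] and [p.+1] meet before leaving the run of
   tests starting at [p]: they stay adjacent until the test of [w], which
   proceeds with the next instruction. *)
Definition merging (X : instr_seq) (f : nat -> bool) (n j p : nat) : Prop :=
  exists2 d, (forall e, e <= d -> var_at X (p + e)) &
  exists w, [/\ w < n, w != j, var_at X (p + d) = Some w
    & f w = reply_at X (p + d)].

(** The invariant allows equal positions, or adjacent ones with [merging] at the lower. A test of
    [j] can lead from the first case to the second, where [jm] supplies the merging, and the test of
    [w] leads back at the latest. *)
Lemma merging_run X n f j p p' s s' t t' :
  IS0 X ->
  (forall q, var_at X q = Some j -> merging X f n j q.+1) ->
  (forall k, k < n -> k != j -> input s k = Some (f k)) ->
  (forall k, k != j -> input s k = input s' k) ->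
  s Out = s' Out -> p' = p \/ p' = p.+1 /\ merging X f n j p ->
  run X p s t -> run X p' s' t' -> t Out = t' Out.
Proof.
move=> X0 jm.
(* The executions exchange roles below, so the induction is on the distance of the lower position
   from the end and not on one derivation. *)
move: {2}(size X - p) (leqnn (size X - p)) => m.
elim: m p p' s s' t t' => [|m IH] p p' s s' t t' pm sf ss oo pp run1 run2.
  have /onth_default Ep : size X <= p by rewrite -subn_eq0 -leqn0.
  by inversion run1; subst; rewrite Ep in H.
have lt_m l : 0 < l -> size X - (p + l) <= m by lia.
case: pp => [?|[? [d dtest [w [wn wj wd fw]]]]]; subst p'; last first.
  have := dtest 0 isT; rewrite addn0 /var_at.
  case Ep: (onth X p) => [u|//] /=; case Ei: (test_var u) => [i|//] _.
  inversion run1 as [? ? H|? ? u' l s1 ? H Eu H1]; subst.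
    by rewrite Ep in H; case: H Ei => ->.
  rewrite Ep in H; case: H => ?; subst u'.
  have [os [b ib El]] := step_test Eu Ei.
  have si k : input s1 k = input s k by apply: (step_input Eu k).
  (* The lower execution either joins the upper one at [p.+1] or leaps over it to [p.+2]; then the
     roles are exchanged and [d] decreases. *)
  case: (b =P step_reply u) El => [Eb|Nb] El.
    apply: (IH (p + l) p.+1 s1 s' t t') => //.
    + by rewrite lt_m // El.
    + by move=> k kn kj; rewrite si sf.
    + by move=> k kj; rewrite si ss.
    + by rewrite os.
    + by left; rewrite El addn1.
  (* For [d = 0] the tested input is [w], whose value forces the joining reply, contrary to [Nb]. *)
  case: d => [|d] in dtest wd fw.
    move: wd fw; rewrite addn0 /var_at /reply_at Ep /= Ei => -[?]; subst w.
    by move=> fi; move: (sf i wn wj); rewrite ib fi => -[/Nb].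
  symmetry; apply: (IH p.+1 (p + l) s' s1 t' t) => //.
  + by move: (lt_m 1 isT); rewrite addn1.
  + by move=> k kn kj; rewrite -ss // sf.
  + by move=> k kj; rewrite si ss.
  + by rewrite os.
  right; split; first by rewrite El addn2.
  exists d; first by move=> e ed; rewrite addSnnS; apply: dtest.
  by exists w; rewrite addSnnS.
inversion run1 as [? ? Ep|? ? u l s1 ? Ep Eu run1']; subst.
  by inversion run2 as [? ? H|? ? ? ? ? ? H Eu]; subst => //;
    rewrite Ep in H; case: H Eu => <-.
inversion run2 as [? ? H|? ? u' l' s1' ? H Eu' run2']; subst.
  by rewrite Ep in H; case: H Eu => ->.
rewrite Ep in H; case: H => ?; subst u'.
have si k : input s1 k = input s k by apply: (step_input Eu k).
have si' k : input s1' k = input s' k by apply: (step_input Eu' k).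
have sf1 k : k < n -> k != j -> input s1 k = Some (f k).
  by move=> kn kj; rewrite si sf.
have sf1' k : k < n -> k != j -> input s1' k = Some (f k).
  by move=> kn kj; rewrite si' -ss // sf.
have ss1 k : k != j -> input s1 k = input s1' k by move=> kj; rewrite si si' ss.
have ss1' k : k != j -> input s1' k = input s1 k by move=> kj; rewrite ss1.
case: (test_var u =P Some j) => [Ej|NEj].
  have mg : merging X f n j p.+1 by apply: jm; rewrite /var_at Ep.
  have [os [b _ El]] := step_test Eu Ej.
  have [os' [b' _ El']] := step_test Eu' Ej.
  have oo1 : s1 Out = s1' Out by rewrite os os'.
  have le1 : size X - p.+1 <= m by move: (lt_m 1 isT); rewrite addn1.
  (* Equal replies keep the positions equal, different ones make them adjacent; in the third case
     the first execution is the upper one. *)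
  case: ifP El => _ El; case: ifP El' => _ El'; subst l l';
    rewrite ?addn1 ?addn2 in run1' run2'.
  + by apply: IH le1 _ _ _ _ run1' run2' => //; left.
  + by apply: IH le1 _ _ _ _ run1' run2' => //; right.
  + by symmetry; apply: IH le1 _ _ _ _ run2' run1' => //; right.
  + by apply: (IH p.+2) run1' run2' => //; [apply: leq_trans le1; lia|left].
have [ll o1]: l = l' /\ (s1 Out = s Out /\ s1' Out = s' Out \/ s1 Out = s1' Out).
  apply: step_indep (IS0_onth X0 Ep) Eu Eu' _ => i Ei; apply: ss.
  by apply/eqP => ij; apply: NEj; rewrite Ei ij.
subst l'; apply: (IH (p + l)) run1' run2' => //.
- exact: lt_m (step_gt0 Eu).
- by case: o1 => [[-> ->]|].
- by left.
Qed.

(** * Counting tests *)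

Section Counting.

Variables (n m : nat) (V : nat -> option nat).

Definition tests (i : nat) : seq nat := [seq q <- iota 0 m | V q == Some i].

Definition light (q : nat) : bool :=
  if V q is Some i then (i < n) && (size (tests i) <= 2) else false.

Hypothesis V_out : forall q, m <= q -> V q = None.

Lemma mem_tests i q : (q \in tests i) = (V q == Some i).
Proof.
rewrite mem_filter mem_iota /= add0n.
by case: ltnP => [|/V_out ->]; rewrite ?andbT ?andbF.
Qed.

(** An input with [r >= 2] tests contributes at most [3 * (r - 2)] positions that are not light, and
    at most one input has fewer tests. With a loss of 6 for that one, the sum is at most
    [3 * (2 * n + 3) - 6 * n + 6 = 15]. *)
Lemma heavy_count :
  m <= 2 * n + 3 ->
  (forall i j, i < n -> j < n -> i != j ->
    size (tests i) <= 1 -> size (tests j) <= 1 -> False) ->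
  count (predC light) (iota 0 m) <= 15.
Proof.
move=> mn one.
pose r i := size (tests i).
pose other q := if V q is Some i then n <= i else true.
have total (s : seq nat) :
    size s = count other s + \sum_(i < n) count (fun q => V q == Some (i : nat)) s.
  elim: s => [|q s IH] /=; first by rewrite big1.
  rewrite big_split /= addnACA -IH -add1n; congr addn; rewrite /other.
  case Eq: (V q) => [i|]; last by rewrite big1.
  case: leqP => ni.
    by rewrite big1 // => k _; case: eqP => // -[ik]; move: (ltn_ord k); rewrite -ik ltnNge ni.
  rewrite (bigD1 (Ordinal ni)) //= eqxx big1 // => k /eqP nk.
  by case: eqP => // -[ik]; case: nk; apply: val_inj.
have heavy : count (predC light) (iota 0 m) =
    count other (iota 0 m) + \sum_(i < n) (2 < r i) * r i.
  have aux (s : seq nat) : count (predC light) s = count other s +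
      \sum_(i < n) (2 < r i) * count (fun q => V q == Some (i : nat)) s.
    elim: s => [|q s IH] /=.
      by rewrite big1 // => i _; rewrite muln0.
    under eq_bigr do rewrite mulnDr.
    rewrite big_split /= addnACA -IH; congr addn; rewrite /other /light.
    case Eq: (V q) => [i|]; last by rewrite big1 // => i _; rewrite muln0.
    case: (ltnP i n) => ni /=.
      rewrite (bigD1 (Ordinal ni)) //= eqxx big1 ?addn0 ?muln1 -?ltnNge // => k /eqP nk.
      by case: eqP => [[ik]|]; rewrite ?muln0 //; case: nk; apply: val_inj.
    rewrite big1 // => k _; case: eqP => [[ik]|]; rewrite ?muln0 //.
    by move: (ltn_ord k); rewrite -ik ltnNge ni.
  rewrite aux; congr addn; apply: eq_bigr => i _; congr muln.
  by rewrite /r /tests size_filter.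
have low : 6 * n + \sum_(i < n) (2 < r i) * r i <= 3 * \sum_(i < n) r i + 6.
  have loc (k : nat) : 1 < k -> 6 + (2 < k) * k <= 3 * k by case: ltnP => ? ?; lia.
  have -> : 6 * n = \sum_(i < n) 6 by rewrite sum_nat_const card_ord mulnC.
  rewrite big_distrr -big_split /=.
  (* The input with at most one test, if there is one, uses up the summand 6. *)
  case: (pickP (fun i : 'I_n => r i <= 1)) => [i ri|all2].
    rewrite (bigD1 i) //= [in X in _ <= X](bigD1 i) //=.
    have: \sum_(k < n | k != i) (6 + (2 < r k) * r k) <= \sum_(k < n | k != i) 3 * r k.
      apply: leq_sum => k ki; apply: loc; rewrite ltnNge; apply/negP => rk.
      exact: (one k i).
    have -> : (2 < r i) = false by rewrite ltnNge ltnW.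
    by rewrite mul0n addn0 addnC leq_add2r => /leq_trans -> //; rewrite leq_addl.
  apply: leq_trans (leq_addr _ _); apply: leq_sum => k _; apply: loc.
  by rewrite ltnNge all2.
have := total (iota 0 m); rewrite size_iota heavy.
have -> : \sum_(i < n) count (fun q => V q == Some (i : nat)) (iota 0 m) =
          \sum_(i < n) r i.
  by apply: eq_bigr => i _; rewrite /r /tests size_filter.
lia.
Qed.

(** Otherwise each of the [n] inputs has a test at a position [q] such that one of [q], [q.+1],
    [q.+2] is not light. There are at most [15 + 16 + 17 = 48] such positions. *)
Lemma exists_light_var :
  count (predC light) (iota 0 m) <= 15 -> 49 <= n ->
  exists2 j, j < n & forall q, V q = Some j ->
    [&& light q, light q.+1 & light q.+2].
Proof.
move=> c15 n49.
pose blocked q := ~~ [&& light q, light q.+1 & light q.+2].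
case: (pickP (fun j : 'I_n => ~~ has blocked (tests j))) => [j /hasPn jl|allb].
  exists j => // q /eqP Vq; apply: negbNE; apply: jl.
  by rewrite mem_tests.
exfalso.
have: n <= count blocked (iota 0 m).
  (* Pigeonhole: the inputs tested at blocked positions include all those below [n]. The default 0
     stands in at positions without a test. *)
  rewrite -{1}(size_iota 0 n) -size_filter.
  rewrite -(size_map (fun q => odflt 0 (V q)) (filter _ _)).
  apply: uniq_leq_size (iota_uniq _ _) _ => i; rewrite mem_iota /= add0n => iN.
  have /negbT := allb (Ordinal iN); rewrite negbK => /hasP[q] /= qi bq.
  have Vq : V q = Some i by apply/eqP; rewrite -mem_tests.
  apply/mapP; exists q; last by rewrite Vq.
  by move: qi; rewrite !mem_filter bq => /andP[].
(* The shift brings in at most [k] further positions, those from [m] on. *)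
have shift k : count (fun q => ~~ light (q + k)) (iota 0 m) <= 15 + k.
  have -> : count (fun q => ~~ light (q + k)) (iota 0 m) =
            count (predC light) (iota k m).
    rewrite -{2}(addn0 k) iotaDl count_map; apply: eq_count => q /=.
    by rewrite addnC.
  apply: (@leq_trans (count (predC light) (iota 0 (k + m)))).
    by rewrite iotaD count_cat leq_addl.
  rewrite addnC iotaD count_cat leq_add //.
  by apply: leq_trans (count_size _ _) _; rewrite size_iota.
have: count blocked (iota 0 m) <= count (fun q => ~~ light (q + 0)) (iota 0 m) +
   (count (fun q => ~~ light (q + 1)) (iota 0 m) +
    count (fun q => ~~ light (q + 2)) (iota 0 m)).
  elim: (iota 0 m) => //= q s; rewrite /blocked addn0 addn1 addn2.
  by case: (light q); case: (light q.+1); case: (light q.+2) => /=; lia.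
have := shift 0; have := shift 1; have := shift 2; lia.
Qed.

End Counting.

(** * Choosing the inputs so that the branches merge *)

Lemma var_at_out X q : size X <= q -> var_at X q = None.
Proof. by move=> Xq; rewrite /var_at onth_default. Qed.

(** A suitable value of the input tested right after a test of [j] merges the branches at once. Two
    tests of [j] can make conflicting demands on one input; the second position after the earlier
    test then offers another choice. *)
Lemma merging_assignment X n j :
  (forall q, var_at X q = Some j -> [&& light n (size X) (var_at X) q,
    light n (size X) (var_at X) q.+1 & light n (size X) (var_at X) q.+2]) ->
  exists f, forall q, var_at X q = Some j -> merging X f n j q.+1.
Proof.
move=> jl; pose T := tests (size X) (var_at X).
have memT i q : (q \in T i) = (var_at X q == Some i).
  exact: mem_tests (@var_at_out X) i q.
have lightP q : light n (size X) (var_at X) q ->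
    exists i, [/\ var_at X q = Some i, i < n & size (T i) <= 2].
  by rewrite /light; case: var_at => // i /andP[iN i2]; exists i.
have only w q : w != j -> forall f, var_at X q.+1 = Some w -> w < n ->
    f w = reply_at X q.+1 -> merging X f n j q.+1.
  move=> wj f Vw wn fw; exists 0; first by case=> //; rewrite addn0 Vw.
  by exists w; rewrite addn0.
case ET: (T j) => [|a [|b [|c l]]].
- by exists (fun=> false) => q /eqP; rewrite -memT ET.
- have memj q : (var_at X q == Some j) = (q == a) by rewrite -memT ET inE.
  have Va : var_at X a = Some j by apply/eqP; rewrite memj.
  have /and3P[_ /lightP[w [Vw wn _]] _] := jl _ Va.
  have wj : w != j.
    apply/eqP => ij; have := memj a.+1; rewrite Vw ij eqxx => /esym/eqP; lia.
  exists (fun=> reply_at X a.+1) => q /eqP; rewrite memj => /eqP ->.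
  exact: only wj _ Vw wn _.
- have [p [q [pq memj]]] : exists p q, p < q /\
      forall x, (var_at X x == Some j) = (x == p) || (x == q).
    have mem2 x : (var_at X x == Some j) = (x == a) || (x == b).
      by rewrite -memT ET !inE.
    have : uniq (T j) by rewrite filter_uniq ?iota_uniq.
    rewrite ET /= inE andbT => ab.
    case: (ltngtP a b) ab => // ab _; first by exists a, b.
    by exists b, a; split=> // x; rewrite mem2 orbC.
  have notj x w : x != p -> x != q -> var_at X x = Some w -> w != j.
    by move=> xp xq Vx; apply/eqP => wj; have := memj x;
      rewrite Vx wj eqxx (negbTE xp) (negbTE xq).
  have Vp : var_at X p = Some j by apply/eqP; rewrite memj eqxx.
  have Vq : var_at X q = Some j by apply/eqP; rewrite memj eqxx orbT.
  have /and3P[_ /lightP[w [Vw wn w2]] _] := jl _ Vq.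
  have /and3P[_ /lightP[u [Vu un u2]] /lightP[v [Vv vn _]]] := jl _ Vp.
  have wj : w != j by apply: notj Vw; lia.
  (* A variable tested at [p.+1] or [p.+2] other than [w] can be given a value
     independently of [w]; otherwise [w] would be tested three times. *)
  have two f : f w = reply_at X q.+1 -> merging X f n j p.+1 ->
      exists f, forall x, var_at X x = Some j -> merging X f n j x.+1.
    move=> fw mp; exists f => x /eqP; rewrite memj => /orP[] /eqP -> //.
    exact: only wj _ Vw wn fw.
  (* If [q] is one or two positions after [p], the run of tests from [p.+1] reaches the test of [w]
     at [q.+1], so one value of [w] serves both tests of [j]. *)
  case: (q =P p.+1) => [qp|/eqP qp].
    apply: (two (fun=> reply_at X q.+1)) => //; exists 1.
      by case=> [|[]] //; rewrite ?addn0 ?addn1 ?Vu ?Vv.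
    by exists w; rewrite addn1 -qp.
  case: (q =P p.+2) => [qp2|/eqP qp2].
    apply: (two (fun=> reply_at X q.+1)) => //; exists 2.
      by case=> [|[|[]]] //; rewrite ?addn0 ?addn1 ?addn2 ?Vu ?Vv // -qp2 Vw.
    by exists w; rewrite addn2 -qp2.
  have uj : u != j by apply: notj Vu; lia.
  have vj : v != j by apply: notj Vv; lia.
  case: (w =P u) => [wu|/eqP wu]; last first.
    apply: (two (fun i => if i == w then reply_at X q.+1 else reply_at X p.+1)).
      by rewrite eqxx.
    by apply: only uj _ Vu un _; rewrite eq_sym (negbTE wu).
  case: (w =P v) => [wv|/eqP wv]; last first.
    apply: (two (fun i => if i == w then reply_at X q.+1 else reply_at X p.+2)).
      by rewrite eqxx.
    exists 1; first by case=> [|[]] //; rewrite ?addn0 ?addn1 ?Vu ?Vv.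
    by exists v; rewrite addn1 (eq_sym v w) (negbTE wv).
  have : size [:: p.+1; p.+2; q.+1] <= size (T w).
    apply: uniq_leq_size => [|x]; first by rewrite /= !inE; lia.
    rewrite !inE memT => /or3P[] /eqP ->; last by rewrite Vw.
      by rewrite Vu wu.
    by rewrite Vv wv.
  by move=> /leq_trans/(_ w2).
(* A third test of [j] would contradict that its test at [a] is light. *)
- have /lightP[i []] : light n (size X) (var_at X) a.
    have : var_at X a == Some j by rewrite -memT ET inE eqxx.
    by move=> /eqP/jl/and3P[].
  have : var_at X a == Some j by rewrite -memT ET inE eqxx.
  by move=> /eqP -> [<-] _; rewrite ET.
Qed.

(** The input whose test comes later becomes [l], so the test of the other lies before [q]. An input
    without tests meets either condition. *)
Lemma tests_le1 X i j :
  i != j -> size (tests (size X) (var_at X) i) <= 1 ->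
  size (tests (size X) (var_at X) j) <= 1 ->
  exists k l q, [/\ (k, l) = (i, j) \/ (k, l) = (j, i),
    forall p, var_at X p = Some l -> p = q &
    forall p, q <= p -> var_at X p <> Some k].
Proof.
move=> ij.
have pos k : size (tests (size X) (var_at X) k) <= 1 ->
    (forall p, var_at X p <> Some k) \/
    exists q, forall p, (var_at X p == Some k) = (p == q).
  have memT := mem_tests (@var_at_out X) k.
  case ET: (tests _ _ _) => [|q [|]] // _.
    by left=> p /eqP; rewrite -memT ET.
  by right; exists q => p; rewrite -memT ET inE.
case/pos=> [ni|[p ip]] /pos[nj|[q jq]].
- by exists i, j, 0; split=> [|p /nj|p _]; [left| |].
- by exists i, j, q; split=> [|p /eqP|p _]; [left|rewrite jq => /eqP|].
- by exists j, i, p; split=> [|p' /eqP|p' _]; [right|rewrite ip => /eqP|].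
have pq : p != q.
  apply/eqP => pq; have := ip p; have := jq q; rewrite !eqxx pq => /eqP -> /eqP[].
  by move=> ji; rewrite ji eqxx in ij.
case: (ltngtP p q) pq => // pq _.
- exists i, j, q; split=> [|x /eqP|x qx /eqP]; first by left.
    by rewrite jq => /eqP.
  by rewrite ip => /eqP xp; lia.
- exists j, i, p; split=> [|x /eqP|x qx /eqP]; first by right.
    by rewrite ip => /eqP.
  by rewrite jq => /eqP xp; lia.
Qed.

(** * The lower bound on the length *)

Lemma parity_size X n init :
  IS0 X -> computes_parity X n init -> 49 <= n -> ~ size X <= 2 * n + 3.
Proof.
move=> X0 Xn n49 Xsize.
have one i j : i < n -> j < n -> i != j ->
    size (tests (size X) (var_at X) i) <= 1 ->
    size (tests (size X) (var_at X) j) <= 1 -> False.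
  move=> iN jN ij i1 j1; have [k [l [q [kl lq nk]]]] := tests_le1 ij i1 j1.
  have [kN lN nkl] : [/\ k < n, l < n & k != l].
    by case: kl => -[-> ->]; split; rewrite // eq_sym.
  apply: (single_tests X0 Xn kN lN nkl (q := q)) => p u.
    by move=> Ep El; apply: lq; rewrite /var_at Ep.
  by move=> qp Ep; apply/eqP => Ek; apply: (nk _ qp); rewrite /var_at Ep.
have c15 := heavy_count Xsize one.
have [j jn jl] := exists_light_var (@var_at_out X) c15 n49.
have [f jf] := merging_assignment jl.
have [in1 o1 [t rt ot]] := Xn f; have [in2 o2 [t' rt' ot']] := Xn (flip f j).
have : t Out = t' Out.
  apply: (merging_run X0 jf) (or_introl erefl) rt rt'.
  - by move=> k kn _; rewrite in1 kn.
  - by move=> k kj; rewrite in1 in2 /flip (negbTE kj) addbF.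
  - by rewrite o1 o2.
by rewrite ot ot' parity_flip // => -[]; case: parity.
Qed.

Theorem theorem3 : ~ complexity_class IS0 (fun n : nat => 2 * n + 3) PAR.
Proof.
move=> [h [[N hN] hX]].
(* From [N] on the bound on [h] holds, and from 49 on the pigeonhole argument applies. *)
have [X [X0 /computes_PAR[init Xn] Xh]] := hX (N + 49).
apply: (parity_size X0 Xn (leq_addl _ _)).
exact: leq_trans Xh (hN _ (leq_addr _ _)).
Qed.
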